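(* Let $G$ be a graph on $n$ vertices with vertex connectivity $\kappa$, where $0\leq\kappa\leq n-1$. Then $SLEE(G)\leq SLEE(K_{(n-1-\kappa,1)\kappa})$, with equality if and only if $G\cong K_{(n-1-\kappa,1)\kappa}$.
   Context: All graphs are finite and simple. For a graph $G$ on $n$ vertices, let $\mathbf{Q}(G)=\mathbf{D}(G)+\mathbf{A}(G)$ be its signless Laplacian matrix, where $\mathbf{A}(G)$ is the adjacency matrix and $\mathbf{D}(G)$ the diagonal matrix of vertex degrees; let $q_1,\dots,q_n$ be the eigenvalues of $\mathbf{Q}(G)$. The signless Laplacian Estrada index of $G$ is $SLEE(G)=\sum_{i=1}^n e^{q_i}$. $G\cup H$ denotes the vertex-disjoint union of graphs $G$ and $H$, and $G\vee H$ denotes their join, obtained from $G\cup H$ by joining every vertex of $G$ to every vertex of $H$. $K_m$ is the complete graph on $m$ vertices. For $p\geq q\geq 1$ and $r\geq 1$, $K_{(p,q)r}=(K_p\cup K_q)\vee K_r$. By convention, $K_{(0,1)(n-1)}$ denotes $K_n$, and $K_{(n-1,1)0}$ denotes $K_{n-1}\cup K_1$. The vertex connectivity of a non-complete graph is the minimum number of vertices whose removal disconnects it ($0$ if the graph is disconnected); the vertex connectivity of $K_n$ is $n-1$. *)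

(* Defs.v *)
From HB Require Import structures.
From mathcomp Require Import all_boot all_order all_algebra.
From mathcomp Require Import spectral.
From mathcomp Require Import classical_sets reals sequences exp.
From mathcomp Require polyrcf complex.

Set Implicit Arguments.
Unset Strict Implicit.
Unset Printing Implicit Defensive.

Import Order.TTheory GRing.Theory Num.Theory.

Local Open Scope ring_scope.

Record sgraph := SGraph {
  vertex :> finType;
  adj : rel vertex;
  adj_sym : symmetric adj;
  adj_irrefl : irreflexive adj }.

Definition isomorphic (G H : sgraph) : Prop :=
  exists f : G -> H, bijective f /\ forall x y, adj (f x) (f y) = adj x y.

Section Constructions.

Variables G H : sgraph.

Definition union_adj (x y : G + H) : bool :=
  match x, y with
  | inl a, inl b => adj a b
  | inr a, inr b => adj a b
  | _, _ => false
  end.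

Lemma union_adj_sym : symmetric union_adj.
Proof. by move=> [a|a] [b|b] //=; rewrite adj_sym. Qed.

Lemma union_adj_irrefl : irreflexive union_adj.
Proof. by move=> [a|a] /=; rewrite adj_irrefl. Qed.

Definition disjoint_union : sgraph := SGraph union_adj_sym union_adj_irrefl.

Definition join_adj (x y : G + H) : bool :=
  match x, y with
  | inl a, inl b => adj a b
  | inr a, inr b => adj a b
  | _, _ => true
  end.

Lemma join_adj_sym : symmetric join_adj.
Proof. by move=> [a|a] [b|b] //=; rewrite adj_sym. Qed.

Lemma join_adj_irrefl : irreflexive join_adj.
Proof. by move=> [a|a] /=; rewrite adj_irrefl. Qed.

Definition graph_join : sgraph := SGraph join_adj_sym join_adj_irrefl.

End Constructions.

Section Complete.

Variable m : nat.

Definition complete_adj (x y : 'I_m) : bool := x != y.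

Lemma complete_adj_sym : symmetric complete_adj.
Proof. by move=> x y; rewrite /complete_adj eq_sym. Qed.

Lemma complete_adj_irrefl : irreflexive complete_adj.
Proof. by move=> x; rewrite /complete_adj eqxx. Qed.

Definition complete_graph : sgraph :=
  SGraph complete_adj_sym complete_adj_irrefl.

End Complete.

Section RemoveVertices.

Variables (G : sgraph) (S : {set G}).

Definition remove_adj (x y : {x : G | x \notin S}) : bool :=
  adj (val x) (val y).

Lemma remove_adj_sym : symmetric remove_adj.
Proof. by move=> x y; rewrite /remove_adj adj_sym. Qed.

Lemma remove_adj_irrefl : irreflexive remove_adj.
Proof. by move=> x; rewrite /remove_adj adj_irrefl. Qed.

Definition remove_vertices : sgraph :=
  SGraph remove_adj_sym remove_adj_irrefl.

End RemoveVertices.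

(* K_{(p,q)r}.  Taken for all p, q, r, with K_0 the graph without vertices,
   the formula covers both conventions for the degenerate parameters up to
   isomorphism: see Kpqr_complete and Kpqr_union below. *)
Definition Kpqr (p q r : nat) : sgraph :=
  graph_join (disjoint_union (complete_graph p) (complete_graph q))
    (complete_graph r).

Lemma Kpqr_complete n : (0 < n)%N ->
  isomorphic (Kpqr 0 1 n.-1) (complete_graph n).
Proof.
case: n => // n _ /=.
pose f (x : Kpqr 0 1 n) : complete_graph n.+1 :=
  match x with inl _ => ord0 | inr i => lift ord0 i end.
exists f; split; last first.
  move=> [[[]//|a]|a] [[[]//|b]|b] //=; rewrite /complete_adj.
  by rewrite !ord1.
exists (fun i => match unlift ord0 i with
                 | Some j => inr j
                 | None => inl (inr ord0) end).
  by move=> [[[]//|a]|a] /=; rewrite ?unlift_none ?liftK ?ord1.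
by move=> i; case: unliftP => [j|] ->.
Qed.

Lemma Kpqr_union p q :
  isomorphic (Kpqr p q 0) (disjoint_union (complete_graph p) (complete_graph q)).
Proof.
exists (fun x : Kpqr p q 0 => match x with
   | inl a => a | inr i => match i with Ordinal _ h => False_rect _ (notF h) end
   end); split; last by move=> [a|[]//] [b|[]//].
by exists inl => [[a|[]]|].
Qed.

Definition is_complete (G : sgraph) : bool :=
  [forall x : G, forall y : G, (x != y) ==> adj x y].

Definition graph_connected (G : sgraph) : bool :=
  [forall x : G, forall y : G, connect (@adj G) x y].

(* In a non-complete graph, removing all vertices but two non-adjacent ones
   disconnects, so the default value #|G| of the minimum is never reached:
   see vertex_connectivity_attained. *)
Definition vertex_connectivity (G : sgraph) : nat :=
  if is_complete G then #|G|.-1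
  else \big[minn/#|G|]_(S : {set G} | ~~ graph_connected (remove_vertices S))
         #|S|.

Definition degree (G : sgraph) (x : G) : nat := #|[set y | adj x y]|.

Section SignlessLaplacian.

Variable R : realType.

(* Vertices are numbered by the fixed enumeration enum_val : 'I_#|G| -> G. *)
Definition adjacency_matrix (G : sgraph) : 'M[R]_#|G| :=
  \matrix_(i, j) (adj (enum_val i) (enum_val j))%:R.

Definition degree_matrix (G : sgraph) : 'M[R]_#|G| :=
  diag_mx (\row_i (degree (enum_val i))%:R).

Definition signless_laplacian (G : sgraph) : 'M[R]_#|G| :=
  degree_matrix G + adjacency_matrix G.

(* The real eigenvalues of A, repeated according to their multiplicities as
   roots of the characteristic polynomial.  For symmetric A these are all the
   eigenvalues: see size_eigenvalues and char_poly_eigenvalues. *)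
Definition eigenvalues n (A : 'M[R]_n) : seq R :=
  flatten [seq nseq (mup x (char_poly A)) x
          | x <- polyrcf.rootsR (char_poly A)].

Definition SLEE (G : sgraph) : R :=
  \sum_(q <- eigenvalues (signless_laplacian G)) expR q.

End SignlessLaplacian.

Lemma vertex_connectivity_attained (G : sgraph) : ~~ is_complete G ->
  exists2 S : {set G}, ~~ graph_connected (remove_vertices S) &
    vertex_connectivity G = #|S|.
Proof.
move=> ncG; rewrite /vertex_connectivity (negbTE ncG).
have [S0 S0d] : exists S : {set G}, ~~ graph_connected (remove_vertices S).
  move: ncG; rewrite negb_forall => /existsP[x].
  rewrite negb_forall => /existsP[y]; rewrite negb_imply => /andP[xy nxy].
  pose S := ~: [set x; y]; exists S.
  have xS : x \notin S by rewrite !inE eqxx.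
  have yS : y \notin S by rewrite !inE eqxx orbT.
  rewrite negb_forall; apply/existsP; exists (Sub x xS).
  rewrite negb_forall; apply/existsP; exists (Sub y yS).
  apply/negP => /connectP[[|z p] /=].
    by move=> _ /(congr1 val) /= yx; rewrite yx eqxx in xy.
  case/andP=> xz _ _; move: xz; rewrite /remove_adj SubK.
  case: z => z /= zS; move: (zS); rewrite !inE negbK => /orP[]/eqP->.
    by rewrite adj_irrefl.
  by rewrite (negbTE nxy).
pose P (S : {set G}) := ~~ graph_connected (remove_vertices S).
case: (@arg_minnP _ S0 P (fun S => #|S|) S0d) => S PS minS.
exists S => //; apply/eqP; rewrite eqn_leq; apply/andP; split.
  have := mem_index_enum S; elim: (index_enum _) => //= T l IHl.
  rewrite inE big_cons -/(P T) => /predU1P[<-|/IHl le_l].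
    by rewrite PS geq_minl.
  by case: (P T) => //; apply: leq_trans (geq_minr _ _) le_l.
elim/big_ind: _ => [|a b|T]; first exact: max_card.
  by rewrite leq_min => -> ->.
exact: minS.
Qed.

Lemma signless_laplacian_sym (R : realType) (G : sgraph) :
  (signless_laplacian R G)^T = signless_laplacian R G.
Proof.
rewrite /signless_laplacian linearD /= /degree_matrix tr_diag_mx; congr (_ + _).
by apply/matrixP => i j; rewrite !mxE adj_sym.
Qed.

Section RealSymmetric.

Import complex.

Lemma char_poly_split_sym (R : realType) n (A : 'M[R]_n) : A^T = A ->
  exists s : seq R, char_poly A = \prod_(x <- s) ('X - x%:P).
Proof.
move=> Asym; pose toC := (real_complex R : {rmorphism R -> complex R}).
pose AC := map_mx toC A.
have ACh : AC \is hermsymmx.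
  apply: realsym_hermsym.
    by apply/is_hermitianmxP; rewrite /= expr0 scale1r map_mx_id // map_trmx Asym.
  apply/mxOverP => i j; rewrite mxE.
  by rewrite complex_real.
have /orthomx_spectralP := hermitian_normalmx ACh.
have := hermitian_spectral_diag_real ACh.
have := spectral_unit AC.
move: (spectralmx AC) (spectral_diag AC) => P d Pu dr ACE.
have cE : char_poly AC = \prod_(i < n) ('X - (d 0 i)%:P).
  rewrite -[RHS](_ : char_poly (diag_mx d) = _); last first.
    rewrite char_poly_trig ?diag_mx_is_trig //.
    by apply: eq_bigr => i _; rewrite mxE eqxx.
  rewrite /char_poly ACE /char_poly_mx !map_mxM.
  rewrite -[X in \det X](_ : map_mx polyC (invmx P) *m
     ('X%:M - map_mx polyC (diag_mx d)) *m map_mx polyC P = _); last first.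
    rewrite mulmxBr mulmxBl; congr (_ - _).
    by rewrite scalar_mxC -mulmxA -map_mxM mulVmx // map_mx1 mulmx1.
  by rewrite !det_mulmx mulrAC -det_mulmx -map_mxM mulVmx // map_mx1 det1 mul1r.
pose s := [seq Re (d 0 i) | i <- enum 'I_n]; exists s.
apply: (map_poly_inj toC); rewrite map_char_poly cE rmorph_prod /=.
rewrite big_map big_enum /=; apply: eq_bigr => i _.
rewrite rmorphB /= map_polyX map_polyC /=; congr (_ - _%:P).
by rewrite /toC RRe_real //; apply: (mxOverP dr).
Qed.

End RealSymmetric.

Lemma perm_eigenvalues (R : realType) n (A : 'M[R]_n) (s : seq R) :
  char_poly A = \prod_(x <- s) ('X - x%:P) -> perm_eq (eigenvalues A) s.
Proof.
move=> E; apply/allP => x _ /=; apply/eqP.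
have p0 : char_poly A != 0 by rewrite monic_neq0 ?char_poly_monic.
rewrite -(mu_prod_XsubC x s) -E /eigenvalues count_flatten -map_comp sumnE big_map.
under eq_bigr do rewrite /= count_nseq.
have rootE y : (y \in polyrcf.rootsR (char_poly A)) = root (char_poly A) y.
  by have := polyrcf.roots_on_rootsR p0 y; rewrite in_itv /=.
have Ur : uniq (polyrcf.rootsR (char_poly A)).
  exact: (sorted_uniq lt_trans ltxx (polyrcf.sorted_roots _ _ _)).
have [xr|xr] := boolP (x \in polyrcf.rootsR (char_poly A)).
  rewrite (bigD1_seq x) //= eqxx mul1n big1 ?addn0 // => y.
  by move/negbTE=> ->.
rewrite big1_seq => [|y /=]; first by rewrite mupNroot // -rootE.
by have [->|_] := eqVneq y x; rewrite ?(negbTE xr).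
Qed.

Lemma char_poly_eigenvalues (R : realType) n (A : 'M[R]_n) : A^T = A ->
  char_poly A = \prod_(x <- eigenvalues A) ('X - x%:P).
Proof.
move=> /char_poly_split_sym[s E].
by rewrite [LHS]E; apply/esym/perm_big/perm_eigenvalues.
Qed.

Lemma size_eigenvalues (R : realType) n (A : 'M[R]_n) : A^T = A ->
  size (eigenvalues A) = n.
Proof.
move=> /char_poly_eigenvalues /(congr1 (fun p : {poly R} => size p)).
by rewrite size_char_poly size_prod_XsubC => -[].
Qed.

(* Main.v *)
(** The power sums of the eigenvalues are the traces of the powers of Q, so
    SLEE G is the sum of tr Q^k / k!.  Since Q is entrywise nonnegative, adding
    edges does not decrease any of these traces and strictly increases tr Q;
    hence SLEE is strictly increasing under edge addition.  A minimum cut with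
    kappa vertices embeds a non-complete G as a spanning subgraph of some
    K_{(p,q)kappa} with p + q + kappa = n, p, q >= 1.  The quotient matrix of
    the three-block partition gives the spectrum of Q(K_{(p,q)r}): n - 2 with
    multiplicity r, p + r - 2 with multiplicity p - 1, q + r - 2 with
    multiplicity q - 1, and two roots whose sum depends only on p + q and r and
    whose product increases with pq.  Monotonicity and convexity of exp then
    favour the most unbalanced choice q = 1. *)

Require Import Defs.
From mathcomp Require Import all_boot all_order all_algebra ring lra zify.
From mathcomp Require Import spectral.
From mathcomp Require Import boolp classical_sets functions reals.
From mathcomp Require Import topology normedtype sequences exp.
From mathcomp Require complex.

Set Implicit Arguments.
Unset Strict Implicit.
Unset Printing Implicit Defensive.

Import Order.TTheory GRing.Theory Num.Theory numFieldNormedType.Exports.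

Local Open Scope ring_scope.

(** * Matrix powers under conjugation, and power sums of eigenvalues *)

Lemma exprmx_conj (F : fieldType) n (P A : 'M[F]_n) k : P \in unitmx ->
  (invmx P *m A *m P) ^+ k = invmx P *m A ^+ k *m P.
Proof.
move=> Pu; elim: k => [|k IHk]; first by rewrite !expr0 mulmx1 mulVmx.
by rewrite !exprS IHk -!mulmxE -!mulmxA mulKVmx.
Qed.

Lemma exprmx_diag (R : comPzRingType) n (d : 'rV[R]_n) k :
  diag_mx d ^+ k = diag_mx (\row_i d 0 i ^+ k).
Proof.
elim: k => [|k IHk].
  by rewrite expr0; apply/matrixP => i j; rewrite !mxE expr0.
rewrite exprS IHk -mulmxE mulmx_diag; congr diag_mx.
by apply/rowP => i; rewrite !mxE exprS.
Qed.

Lemma exprmx_map (R S : pzSemiRingType) (f : {rmorphism R -> S}) n (A : 'M_n) k :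
  map_mx f A ^+ k = map_mx f (A ^+ k).
Proof.
elim: k => [|k IHk]; first by rewrite !expr0 map_mx1.
by rewrite !exprS IHk -!mulmxE map_mxM.
Qed.

Lemma char_poly_conj (F : fieldType) n (P A : 'M[F]_n) : P \in unitmx ->
  char_poly (invmx P *m A *m P) = char_poly A.
Proof.
move=> Pu; rewrite /char_poly /char_poly_mx !map_mxM.
rewrite -[X in \det X = _](_ : map_mx polyC (invmx P) *m
   ('X%:M - map_mx polyC A) *m map_mx polyC P = _); last first.
  rewrite mulmxBr mulmxBl; congr (_ - _).
  by rewrite scalar_mxC -mulmxA -map_mxM mulVmx // map_mx1 mulmx1.
by rewrite !det_mulmx mulrAC -det_mulmx -map_mxM mulVmx // map_mx1 det1 mul1r.
Qed.

Section PowerSums.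

Import complex.

(** Over the complex numbers the spectral theorem diagonalises [A], which turns the trace into a
    power sum of the diagonal entries; unique factorisation of the characteristic polynomial
    identifies these entries with [eigenvalues A]. *)
Lemma sum_eigenvalues_exp (R : realType) n (A : 'M[R]_n) k : A^T = A ->
  \sum_(x <- eigenvalues A) x ^+ k = \tr (A ^+ k).
Proof.
move=> Asym; pose toC := (real_complex R : {rmorphism R -> complex R}).
pose AC := map_mx toC A.
have ACh : AC \is hermsymmx.
  apply: realsym_hermsym.
    by apply/is_hermitianmxP; rewrite /= expr0 scale1r map_mx_id // map_trmx Asym.
  by apply/mxOverP => i j; rewrite mxE complex_real.
have /orthomx_spectralP := hermitian_normalmx ACh.
have := spectral_unit AC; set P := spectralmx AC; set d := spectral_diag AC.
move=> Pu /= ACE.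
have cE : char_poly AC = \prod_(x <- codom (d 0)) ('X - x%:P).
  rewrite ACE char_poly_conj // char_poly_trig ?diag_mx_is_trig //.
  rewrite big_map big_enum /=.
  by apply: eq_bigr => i _; rewrite mxE eqxx.
have sE : perm_eq (map toC (eigenvalues A)) (codom (d 0)).
  apply: prod_XsubC_eq; rewrite -cE -map_char_poly char_poly_eigenvalues //.
  rewrite rmorph_prod big_map; apply: eq_bigr => x _.
  by rewrite rmorphB /= map_polyX map_polyC.
apply: (fmorph_inj toC); rewrite -trace_map_mx -exprmx_map -/AC ACE.
rewrite exprmx_conj // mxtrace_mulC mulmxA mulmxV // mul1mx exprmx_diag.
rewrite mxtrace_diag rmorph_sum /=.
under eq_bigr do rewrite rmorphXn /=.
rewrite -(big_map toC xpredT (fun x => x ^+ k)) (perm_big _ sE) /=.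
by rewrite big_map big_enum /=; apply: eq_bigr => i _; rewrite mxE.
Qed.

End PowerSums.

(** * Exponential sums as limits of weighted power sums *)

Section ExpSums.
Local Open Scope classical_set_scope.
Variable R : realType.
Implicit Types s t : seq R.

Lemma cvg_sum_expR s :
  (fun N => \sum_(0 <= k < N) k`!%:R^-1 * \sum_(x <- s) x ^+ k) @ \oo
    --> \sum_(x <- s) expR x.
Proof.
elim: s => [|x s IHs].
  rewrite big_nil (_ : (fun _ => _) = fun=> 0); first exact: cvg_cst.
  by apply/funext => N; apply: big1 => k _; rewrite big_nil mulr0.
rewrite big_cons (_ : (fun _ => _) = series (exp_coeff x) + (fun N =>
   \sum_(0 <= k < N) k`!%:R^-1 * \sum_(x <- s) x ^+ k)); last first.
  apply/funext => N; rewrite fctE /series /= -big_split /=.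
  by apply: eq_bigr => k _; rewrite big_cons mulrDr exp_coeffE.
exact: cvgD (is_cvg_series_exp_coeff x) IHs.
Qed.

(** The difference of the two exponential series has nonnegative terms, so it is at least its
    partial sum of orders 0 and 1. Keeping the first-order term lets the bound detect strict
    inequality. *)
Lemma sum_expR_gap s t :
  (forall k, \sum_(x <- s) x ^+ k <= \sum_(x <- t) x ^+ k) ->
  \sum_(x <- s) expR x + (\sum_(x <- t) x - \sum_(x <- s) x)
    <= \sum_(x <- t) expR x.
Proof.
move=> st; rewrite addrC -lerBrDr.
pose u N := \sum_(0 <= k < N) k`!%:R^-1 * \sum_(x <- t) x ^+ k
  - \sum_(0 <= k < N) k`!%:R^-1 * \sum_(x <- s) x ^+ k.
have ucvg : u @ \oo --> \sum_(x <- t) expR x - \sum_(x <- s) expR x.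
  exact: cvgB (@cvg_sum_expR t) (@cvg_sum_expR s).
have uE N : u N =
  \sum_(0 <= k < N) k`!%:R^-1 * (\sum_(x <- t) x ^+ k - \sum_(x <- s) x ^+ k).
  by rewrite /u -sumrB; apply: eq_bigr => k _; rewrite mulrBr.
have u_ge0 k :
  0 <= k`!%:R^-1 * (\sum_(x <- t) x ^+ k - \sum_(x <- s) x ^+ k).
  by rewrite mulr_ge0 ?subr_ge0 // invr_ge0 ler0n.
have undec : {homo u : m n / (m <= n)%N >-> m <= n}.
  move=> m n mn; rewrite !uE (big_cat_nat _ mn) //= lerDl.
  by apply: sumr_ge0 => k _; exact: u_ge0.
rewrite -(cvg_lim _ ucvg) //.
apply: le_trans (nondecreasing_cvgn_le undec _ 2).
  rewrite uE !big_nat_recr ?big_geq //= add0r invr1 mul1r.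
  have := u_ge0 0%N; rewrite fact0 invr1 !mul1r => u0.
  by rewrite lerDr.
exact: (cvgP _ ucvg).
Qed.

End ExpSums.

(** * Monotonicity of [SLEE] under bijective homomorphisms *)

Section GraphMorphisms.
Variable R : realType.
Implicit Types G H : sgraph.

Lemma SLEE_gap G H :
  (forall k, \tr (signless_laplacian R G ^+ k) <= \tr (signless_laplacian R H ^+ k)) ->
  SLEE R G + (\tr (signless_laplacian R H) - \tr (signless_laplacian R G))
    <= SLEE R H.
Proof.
have trE K k := @sum_eigenvalues_exp R _ _ k (signless_laplacian_sym R K).
move=> le_tr; have := @sum_expR_gap R (eigenvalues (signless_laplacian R G))
  (eigenvalues (signless_laplacian R H)).
have /= -> := trE G 1; have /= -> := trE H 1.
by apply=> k; rewrite !trE.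
Qed.

(** Power sums determine the exponential sum through its series, so [s] need never be matched with
    the list of eigenvalues itself. *)
Lemma SLEE_spectrum G (s : seq R) :
  (forall k, \tr (signless_laplacian R G ^+ k) = \sum_(x <- s) x ^+ k) ->
  SLEE R G = \sum_(x <- s) expR x.
Proof.
move=> trs; have trE k := @sum_eigenvalues_exp R _ _ k (signless_laplacian_sym R G).
apply: cvg_unique (@cvg_sum_expR R s) => //.
have := @cvg_sum_expR R (eigenvalues (signless_laplacian R G)).
under eq_cvg do under eq_bigr do rewrite trE trs.
by [].
Qed.

Variables (G H : sgraph) (f : G -> H).
Hypotheses (f_bij : bijective f) (f_hom : forall x y, adj x y -> adj (f x) (f y)).

Let sigma (i : 'I_#|G|) : 'I_#|H| := enum_rank (f (enum_val i)).

Let sigma_bij : bijective sigma.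
Proof. exact: bij_comp (enum_rank_bij H) (bij_comp f_bij (enum_val_bij G)). Qed.

Let degree_f x : (degree x <= degree (f x))%N.
Proof.
rewrite /degree -(card_imset _ (bij_inj f_bij)); apply: subset_leq_card.
by apply/fintype.subsetP => _ /imsetP[y + ->]; rewrite !inE; apply: f_hom.
Qed.

Let le_entry i j :
  signless_laplacian R G i j <= signless_laplacian R H (sigma i) (sigma j).
Proof.
rewrite !mxE !enum_rankK (inj_eq (bij_inj sigma_bij)) lerD //.
  by case: eqP => // _; rewrite ler_nat.
by rewrite ler_nat; case: adj (@f_hom (enum_val i) (enum_val j)) => // ->.
Qed.

Let entry_ge0 K i j : 0 <= signless_laplacian R K i j.
Proof. by rewrite !mxE addr_ge0 ?mulrn_wge0. Qed.

(** Nonnegativity is carried through the same induction because multiplying inequalities requires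
    nonnegative factors. *)
Let le_entry_exp k i j :
  0 <= (signless_laplacian R G ^+ k) i j
    <= (signless_laplacian R H ^+ k) (sigma i) (sigma j).
Proof.
elim: k i j => [|k IHk] i j.
  by rewrite !expr0 !mxE (inj_eq (bij_inj sigma_bij)) lexx ler0n.
rewrite !exprS -!mulmxE !mxE (reindex sigma) /=; last exact: onW_bij.
apply/andP; split; first by apply: sumr_ge0 => l _; rewrite mulr_ge0 //;
  case/andP: (IHk l j).
by apply: ler_sum => l _; have /andP[? ?] := IHk l j; apply: ler_pM.
Qed.

Lemma SLEE_hom_gap :
  SLEE R G + (\tr (signless_laplacian R H) - \tr (signless_laplacian R G))
    <= SLEE R H.
Proof.
apply: SLEE_gap => k; rewrite /mxtrace [leRHS](reindex sigma) /=; last exact: onW_bij.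
by apply: ler_sum => i _; case/andP: (le_entry_exp k i i).
Qed.

Lemma SLEE_hom_le : SLEE R G <= SLEE R H.
Proof.
apply: le_trans SLEE_hom_gap; rewrite lerDl subr_ge0.
rewrite /mxtrace [leRHS](reindex sigma) /=; last exact: onW_bij.
by apply: ler_sum => i _; exact: le_entry.
Qed.

(** An edge of [H] that does not come from [G] raises a degree, hence the trace of the signless
    Laplacian, and the gap bound then excludes equality. *)
Lemma SLEE_hom_eq : SLEE R G = SLEE R H -> isomorphic G H.
Proof.
move=> eqGH; exists f; split=> // x y; apply/idP/idP; last exact: f_hom.
move=> fxy; apply: contraT => nxy.
have := SLEE_hom_gap; rewrite eqGH gerDl subr_le0 leNgt => /negP[].
rewrite /mxtrace [ltRHS](reindex sigma) /=; last exact: onW_bij.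
rewrite (bigD1 (enum_rank x)) //= [ltRHS](bigD1 (enum_rank x)) //=.
apply: ltr_leD; last by apply: ler_sum => i _; exact: le_entry.
rewrite !mxE !eqxx !enum_rankK !adj_irrefl !addr0 ltr_nat.
rewrite /degree -(card_imset _ (bij_inj f_bij)); apply: proper_card.
apply/properP; split.
  by apply/fintype.subsetP => _ /imsetP[z + ->]; rewrite !inE; apply: f_hom.
(* The vertex [f y] is a neighbour of [f x] that is not the image of a neighbour of [x]. *)
by exists (f y); rewrite ?inE // (mem_imset _ _ (bij_inj f_bij)) inE.
Qed.

End GraphMorphisms.

Lemma SLEE_isomorphic (R : realType) G H : isomorphic G H -> SLEE R G = SLEE R H.
Proof.
case=> f [f_bij fE]; apply/eqP; rewrite eq_le; apply/andP; split.
  by apply: SLEE_hom_le f_bij _ => x y; rewrite fE.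
case: (f_bij) => g fK gK; apply: (@SLEE_hom_le R H G g); first by exists f.
by move=> x y; rewrite -{1}(gK x) -{1}(gK y) fE.
Qed.

(** * Spectrum of the signless Laplacian of [Kpqr] *)

(* The columns of P span a subspace invariant under E + P B P', on which that
   matrix acts as D + B P' P and E acts as D; modulo it the two agree. *)
Lemma mxtrace_lowrank_exp (R : comPzRingType) n m (E : 'M[R]_n) (D B : 'M[R]_m)
    (P : 'M[R]_(n, m)) (P' : 'M[R]_(m, n)) k :
  E *m P = P *m D -> P' *m E = D *m P' ->
  \tr ((E + P *m B *m P') ^+ k) =
    \tr (E ^+ k) - \tr (D ^+ k) + \tr ((D + B *m (P' *m P)) ^+ k).
Proof.
move=> EP PE; set M := D + _.
have PEk j : P' *m E ^+ j = D ^+ j *m P'.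
  elim: j => [|j IHj]; first by rewrite !expr0 mulmx1 mul1mx.
  by rewrite exprS -mulmxE mulmxA PE -mulmxA IHj mulmxA mulmxE -exprS.
have EkP j : E ^+ j *m P = P *m D ^+ j.
  elim: j => [|j IHj]; first by rewrite !expr0 mulmx1 mul1mx.
  by rewrite !exprS -!mulmxE -mulmxA IHj mulmxA EP -mulmxA.
(* The correction to [E ^+ k] keeps the shape [P *m C *m P']. By cyclicity its trace is that of
   [C *m (P' *m P)], which is what the second invariant records. *)
have [C [-> CP]] : exists C, (E + P *m B *m P') ^+ k = E ^+ k + P *m C *m P' /\
    C *m (P' *m P) = M ^+ k - D ^+ k.
  elim: k => [|k [C [IHk CP]]].
    by exists 0; rewrite !expr0 mulmx0 !mul0mx addr0 subrr.
  (* Found by expanding [(E + P *m B *m P') *m (E ^+ k + P *m C *m P')] and pulling [P] and [P'] to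
     the outside. *)
  exists (M *m C + B *m D ^+ k); split.
    have MC : P *m (M *m C) = P *m D *m C + P *m B *m P' *m P *m C.
      by rewrite /M mulmxDl mulmxDr !mulmxA.
    rewrite !exprS IHk -!mulmxE mulmxDl !mulmxDr -addrA MC; congr (_ + _).
    by rewrite -(mulmxA _ P') PEk !mulmxDl !mulmxA EP [RHS]addrAC addrA.
  have MD : M *m D ^+ k = D *m D ^+ k + B *m D ^+ k *m P' *m P.
    rewrite /M mulmxDl; congr (_ + _).
    by rewrite -!mulmxA (mulmxA (D ^+ k)) -PEk -mulmxA EkP.
  rewrite mulmxDl -!mulmxA CP mulmxBr MD !exprS -!mulmxE opprD !mulmxA.
  by rewrite addrA subrK.
rewrite linearD /= -mulmxA mxtrace_mulC -mulmxA CP linearB /=.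
by rewrite addrA addrAC.
Qed.

Lemma cubic_recurrence_eq (R : comPzRingType) (a b c : R) (u v : nat -> R) :
  (forall k, u k.+3 = a * u k.+2 + b * u k.+1 + c * u k) ->
  (forall k, v k.+3 = a * v k.+2 + b * v k.+1 + c * v k) ->
  u 0%N = v 0%N -> u 1%N = v 1%N -> u 2%N = v 2%N -> u =1 v.
Proof.
move=> uS vS uv0 uv1 uv2 k.
suff [] : [/\ u k = v k, u k.+1 = v k.+1 & u k.+2 = v k.+2] by [].
by elim: k => // k [e0 e1 e2]; split=> //; rewrite uS vS e0 e1 e2.
Qed.

Section Spectrum.
Variables (R : realType) (p q r : nat).
Local Notation pR := (p%:R : R).
Local Notation qR := (q%:R : R).
Local Notation rR := (r%:R : R).

Definition kpqr_class (x : Kpqr p q r) : 'I_3 :=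
  match x with inl (inl _) => @Ordinal 3 0 isT | inl (inr _) => @Ordinal 3 1 isT
  | inr _ => @Ordinal 3 2 isT end.

(** Adjacency between classes with loops allowed: every class is a clique, and the class of index 2,
    [K_r], is joined to all. *)
Definition kpqr_block (i j : 'I_3) : bool := [|| i == j, i == 2 :> nat | j == 2 :> nat].

Lemma kpqr_adjE (x y : Kpqr p q r) :
  adj x y = (x != y) && kpqr_block (kpqr_class x) (kpqr_class y).
Proof. by move: x y => [[a|a]|a] [[b|b]|b] //=; rewrite /complete_adj andbT. Qed.

Definition kpqr_size (j : 'I_3) : nat := nth 0%N [:: p; q; r] j.

Lemma sum_kpqr_class (V : nmodType) (F : 'I_3 -> V) :
  \sum_(x : Kpqr p q r) F (kpqr_class x) = \sum_j F j *+ kpqr_size j.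
Proof.
rewrite big_sumType big_sumType /= !sumr_const !card_ord !big_ord_recl big_ord0 /=.
rewrite addr0 addrA /kpqr_size /=.
by congr (F _ *+ _ + F _ *+ _ + F _ *+ _); apply: val_inj.
Qed.

Lemma kpqr_degree (x : Kpqr p q r) : (degree x)%:R =
   \sum_(j | kpqr_block (kpqr_class x) j) (kpqr_size j)%:R - 1 :> R.
Proof.
apply/eqP; rewrite eq_sym subr_eq; apply/eqP.
rewrite /degree -sum1_card natr_sum.
transitivity (\sum_(y : Kpqr p q r) (kpqr_block (kpqr_class x) (kpqr_class y))%:R : R).
  rewrite (sum_kpqr_class (fun j => (kpqr_block _ j)%:R)) big_mkcond /=.
  by apply: eq_bigr => j _; case: kpqr_block; rewrite ?mul0rn.
rewrite (bigD1 x) //= {1}/kpqr_block eqxx addrC; congr (_ + _).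
rewrite big_mkcond [RHS]big_mkcond; apply: eq_bigr => y _.
rewrite inE -[join_adj x y]/(@adj (Kpqr p q r) x y) kpqr_adjE eq_sym.
by case: eqP => //=; case: kpqr_block.
Qed.

(** This is the degree minus one. The block sum counts the vertex itself, and one more unit offsets
    the ones that the block matrix has on its diagonal. *)
Definition kpqr_diag (j : 'I_3) : R :=
  \sum_(i | kpqr_block j i) (kpqr_size i)%:R - 2.

(** The quotient matrix of the signless Laplacian for the equitable partition into the three
    classes. *)
Definition kpqr_quotient : 'M[R]_3 := diag_mx (\row_j kpqr_diag j) +
  \matrix_(i, j) (kpqr_block i j)%:R *m diag_mx (\row_j (kpqr_size j)%:R).

(** The signless Laplacian is a diagonal matrix, constant on classes, plus [P *m B *m P^T] with [P]
    the class indicator matrix, so the low-rank trace formula applies. Keeping the two sums apart,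
    rather than using multiplicities [size - 1], covers empty classes. *)
Lemma kpqr_trace k : \tr (signless_laplacian R (Kpqr p q r) ^+ k) =
   \sum_j kpqr_diag j ^+ k *+ kpqr_size j - \sum_j kpqr_diag j ^+ k
   + \tr (kpqr_quotient ^+ k).
Proof.
pose c (i : 'I_#|Kpqr p q r|) := kpqr_class (enum_val i).
pose E : 'M[R]__ := diag_mx (\row_i kpqr_diag (c i)).
pose P : 'M[R]_(_, 3) := \matrix_(i, j) (c i == j)%:R.
pose B : 'M[R]_3 := \matrix_(i, j) (kpqr_block i j)%:R.
pose D : 'M[R]_3 := diag_mx (\row_j kpqr_diag j).
have sum_delta (F : 'I_3 -> R) i : \sum_j (i == j)%:R * F j = F i.
  rewrite (bigD1 i) //= eqxx mul1r big1 ?addr0 // => j.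
  by rewrite eq_sym => /negbTE->; rewrite mul0r.
have -> : signless_laplacian R (Kpqr p q r) = E + P *m B *m P^T.
  apply/matrixP => i j; rewrite [RHS]mxE [(_ *m P^T) i j]mxE.
  under eq_bigr => l _ do rewrite mulrC [P^T l j]mxE [P j l]mxE [(_ *m _) _ _]mxE.
  rewrite (sum_delta (fun l => _)).
  under eq_bigr => l _ do rewrite [P _ _]mxE.
  rewrite (sum_delta (fun l => B l _)) !mxE kpqr_adjE kpqr_degree /kpqr_diag.
  rewrite (inj_eq enum_val_inj) -/(c i) -/(c j).
  case: eqP => [<-|] //=.
  by rewrite /kpqr_block eqxx !mulr1n /=; ring.
rewrite (@mxtrace_lowrank_exp _ _ _ E D).
- congr (_ - _ + _).
  + rewrite exprmx_diag mxtrace_diag -(sum_kpqr_class (fun j => _ ^+ k)).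
    rewrite (reindex (fun i : 'I_#|Kpqr p q r| => enum_val i)) /=;
      last exact: onW_bij (enum_val_bij _).
    by apply: eq_bigr => i _; rewrite !mxE.
  + by rewrite exprmx_diag mxtrace_diag; apply: eq_bigr => i _; rewrite !mxE.
  + congr (\tr (_ ^+ k)); rewrite /kpqr_quotient; congr (_ + _ *m _).
    (* The Gram matrix [P^T *m P] is the diagonal matrix of class sizes. *)
    apply/matrixP => i j; rewrite [LHS]mxE.
    under eq_bigr => l _ do rewrite 2!mxE [P l j]mxE.
    transitivity (\sum_(x : Kpqr p q r)
      (kpqr_class x == i)%:R * (kpqr_class x == j)%:R : R).
      rewrite [RHS](reindex (fun i : 'I_#|Kpqr p q r| => enum_val i)) //=.
      exact: onW_bij (enum_val_bij _).
    rewrite (sum_kpqr_class (fun l => (l == i)%:R * (l == j)%:R)) !mxE.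
    rewrite (bigD1 i) //= eqxx mul1r.
    rewrite big1 ?addr0 => [|l /negbTE->]; last by rewrite mul0r mul0rn.
    by case: (i == j); rewrite ?mul0rn.
- apply/matrixP => i j; rewrite mul_diag_mx mul_mx_diag !mxE.
  by case: eqP => [->|]; rewrite ?mul0r ?mulr0 // mulrC.
- apply/matrixP => i j; rewrite mul_diag_mx mul_mx_diag !mxE.
  by case: eqP => [->|]; rewrite ?mul0r ?mulr0 // mulrC.
Qed.

(* The characteristic polynomial of the quotient matrix factors as
   (X - lam) (X^2 - tsum X + tprod). *)
Let lam : R := pR + qR + rR - 2.
Let tsum : R := 2 * (pR + qR) + 3 * rR - 4.
Let tprod : R := 4 * pR * qR + (rR - 2) * (2 * (pR + qR) + 2 * rR - 2).

Lemma kpqr_quotientE : kpqr_quotient = \matrix_(i, j) nth 0 (nth [::]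
  [:: [:: 2 * pR + rR - 2; 0; rR]; [:: 0; 2 * qR + rR - 2; rR];
      [:: pR; qR; pR + qR + 2 * rR - 2]] i) j.
Proof.
apply/matrixP => i j; rewrite /kpqr_quotient mul_mx_diag !mxE /kpqr_diag big_mkcond /=.
rewrite !big_ord_recl big_ord0 /kpqr_block /kpqr_size -!val_eqE /=.
by case: i j => [[|[|[|]]] //= ?] [[|[|[|]]] //= ?];
  rewrite -?val_eqE /= ?mulr1n ?mulr0n; ring.
Qed.

(** The Cayley-Hamilton identity for the factored cubic, verified entry by entry so that no
    determinant has to be computed. *)
Lemma kpqr_quotient_cubic : kpqr_quotient ^+ 3 =
  (lam + tsum) *: kpqr_quotient ^+ 2 - (lam * tsum + tprod) *: kpqr_quotient
  + (lam * tprod)%:M.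
Proof.
rewrite kpqr_quotientE; set M := \matrix_(i, j) _.
have ME i j : M i j = nth 0 (nth [::]
  [:: [:: 2 * pR + rR - 2; 0; rR]; [:: 0; 2 * qR + rR - 2; rR];
      [:: pR; qR; pR + qR + 2 * rR - 2]] i) j by rewrite mxE.
pose o0 : 'I_3 := @Ordinal 3 0 isT; pose o1 : 'I_3 := @Ordinal 3 1 isT.
pose o2 : 'I_3 := @Ordinal 3 2 isT.
have mulE (A : 'M[R]_3) i j :
  (M *m A) i j = M i o0 * A o0 j + M i o1 * A o1 j + M i o2 * A o2 j.
  rewrite mxE !big_ord_recl big_ord0 addr0 addrA.
  by congr (M i _ * A _ j + M i _ * A _ j + M i _ * A _ j); apply: val_inj.
have addmxE (A C : 'M[R]_3) i j : (A + C) i j = A i j + C i j by rewrite mxE.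
have oppmxE (A : 'M[R]_3) i j : (- A) i j = - A i j by rewrite mxE.
have scalemxE a (A : 'M[R]_3) i j : (a *: A) i j = a * A i j by rewrite mxE.
rewrite 2!exprS expr1 -!mulmxE; apply/matrixP => i j.
rewrite !addmxE oppmxE !scalemxE.
rewrite !mulE !ME [_%:M i j]mxE /lam /tsum /tprod -!val_eqE /=.
by case: i j => [[|[|[|]]] //= ?] [[|[|[|]]] //= ?];
  rewrite -?val_eqE /= ?mulr1n ?mulr0n; ring.
Qed.

(** The discriminant [tsum ^+ 2 - 4 * tprod], written as a sum of nonnegative terms. For fixed p + q
    and r it depends only on the square of p - q. *)
Let disc : R := 4 * (pR - qR) ^+ 2 + 4 * (pR + qR) * rR + rR ^+ 2.
Let root_hi : R := (tsum + Num.sqrt disc) / 2.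
Let root_lo : R := (tsum - Num.sqrt disc) / 2.

Let disc_ge0 : 0 <= disc.
Proof.
have sq : 0 <= (pR - qR) ^+ 2 by apply: sqr_ge0.
have pqr : 0 <= (pR + qR) * rR by rewrite mulr_ge0 ?addr_ge0.
have r2 : 0 <= rR ^+ 2 by apply: sqr_ge0.
by rewrite /disc; lra.
Qed.

Let root_hiE : root_hi ^+ 2 = tsum * root_hi - tprod.
Proof.
have := sqr_sqrtr disc_ge0; rewrite /root_hi /disc /tsum /tprod.
by set s := Num.sqrt _; move=> sE; field: sE.
Qed.

Let root_loE : root_lo ^+ 2 = tsum * root_lo - tprod.
Proof.
have := sqr_sqrtr disc_ge0; rewrite /root_lo /disc /tsum /tprod.
by set s := Num.sqrt _; move=> sE; field: sE.
Qed.

(** Both sides satisfy the recurrence given by the cubic and agree for k = 0, 1, 2; no eigenvectors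
    are needed. *)
Lemma kpqr_quotient_trace k :
  \tr (kpqr_quotient ^+ k) = lam ^+ k + root_hi ^+ k + root_lo ^+ k.
Proof.
pose u k := \tr (kpqr_quotient ^+ k).
pose v k := lam ^+ k + root_hi ^+ k + root_lo ^+ k.
move: k; apply: (@cubic_recurrence_eq _ (lam + tsum) (- (lam * tsum + tprod))
  (lam * tprod) u v) => [k|k|||].
- rewrite /u -[k.+3]addn3 exprD kpqr_quotient_cubic mulrDr mulrBr.
  rewrite -!scalerAr -exprD -exprSr addn2 -mulmxE -scalemx1 -scalemxAr mulmx1.
  by rewrite !mxtraceD [\tr (- _)]linearN /= !mxtraceZ mulNr.
- rewrite /v !(exprSr _ k.+2) !(exprSr _ k.+1) !(exprSr _ k).
  have step x : x ^+ 2 = tsum * x - tprod ->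
      x ^+ k * x * x * x = (lam + tsum) * (x ^+ k * x * x)
        - (lam * tsum + tprod) * (x ^+ k * x) + lam * tprod * x ^+ k.
    move=> xE; apply/eqP; rewrite -subr_eq0; apply/eqP.
    transitivity (x ^+ k * (x - lam) * (x ^+ 2 - (tsum * x - tprod))); first by ring.
    by rewrite xE subrr mulr0.
  rewrite (step root_hi) // (step root_lo) //; ring.
- by rewrite /u /v !expr0 mxtrace1; ring.
- rewrite /u /v !expr1 kpqr_quotientE /mxtrace !big_ord_recl big_ord0 !mxE /=.
  rewrite /root_hi /root_lo /lam /tsum; by field.
  rewrite /u /v root_hiE root_loE !exprS !expr0 mulr1 -mulmxE kpqr_quotientE.
  rewrite /mxtrace !big_ord_recl big_ord0 !mxE !big_ord_recl !big_ord0 !mxE /=.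
  rewrite /root_hi /root_lo /lam /tsum /tprod; by field.
Qed.

(** The diagonal value of the class [K_r] equals [lam], so its r - 1 copies merge with the root
    [lam] of the quotient into r copies, which also covers r = 0. Positivity of p and q makes p - 1
    and q - 1 genuine multiplicities. *)
Lemma SLEE_Kpqr : (0 < p)%N -> (0 < q)%N -> SLEE R (Kpqr p q r) =
  rR * expR (pR + qR + rR - 2) + (pR - 1) * expR (pR + rR - 2)
  + (qR - 1) * expR (qR + rR - 2)
  + (expR ((2 * (pR + qR) + 3 * rR - 4
       + Num.sqrt (4 * (pR - qR) ^+ 2 + 4 * (pR + qR) * rR + rR ^+ 2)) / 2)
   + expR ((2 * (pR + qR) + 3 * rR - 4
       - Num.sqrt (4 * (pR - qR) ^+ 2 + 4 * (pR + qR) * rR + rR ^+ 2)) / 2)).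
Proof.
move=> p_gt0 q_gt0.
have p1E : (p.-1)%:R = pR - 1 by rewrite -subn1 natrB.
have q1E : (q.-1)%:R = qR - 1 by rewrite -subn1 natrB.
pose s := nseq r lam ++ nseq p.-1 (pR + rR - 2) ++ nseq q.-1 (qR + rR - 2)
  ++ [:: root_hi; root_lo].
have sumE (f : R -> R) : \sum_(x <- s) f x = rR * f lam
    + (pR - 1) * f (pR + rR - 2) + (qR - 1) * f (qR + rR - 2)
    + (f root_hi + f root_lo).
  rewrite !big_cat !big_nseq !iter_addr_0 !big_cons big_nil /= addr0 !addrA.
  by rewrite -!(mulr_natl (f _)) p1E q1E.
rewrite (@SLEE_spectrum R _ s) ?sumE // => k.
rewrite kpqr_trace kpqr_quotient_trace sumE.
have diagE : [/\ kpqr_diag ord0 = pR + rR - 2, kpqr_diag (lift ord0 ord0) = qR + rR - 2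
   & kpqr_diag (lift ord0 (lift ord0 ord0)) = lam].
  by split; rewrite /kpqr_diag big_mkcond !big_ord_recl big_ord0 /kpqr_block
    /kpqr_size -?val_eqE /= /lam; ring.
rewrite !big_ord_recl !big_ord0 /kpqr_size /= -!(mulr_natl (_ ^+ k)).
by case: diagE => -> -> ->; ring.
Qed.

End Spectrum.

(** * Comparison of the graphs [Kpqr] with p + q and r fixed *)

(** After factoring out [expR (a / 2)], this is the monotonicity of y + 1/y for y at least 1. *)
Lemma expR_spread_le (R : realType) (a d d' : R) : 0 <= d -> d <= d' ->
  expR ((a + d) / 2) + expR ((a - d) / 2) <=
  expR ((a + d') / 2) + expR ((a - d') / 2).
Proof.
move=> d0 dd'; have E x : expR ((a + x) / 2) + expR ((a - x) / 2)
   = expR (a / 2) * (expR (x / 2) + (expR (x / 2))^-1).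
  by rewrite mulrDr -expRN -!expRD; congr (expR _ + expR _); field.
rewrite !E ler_pM2l ?expR_gt0 // -subr_ge0.
set y := expR (d / 2); set z := expR (d' / 2).
have y0 : 0 < y := expR_gt0 _; have z0 : 0 < z := expR_gt0 _.
have y1 : 1 <= y by rewrite -expR0 ler_expR divr_ge0.
have yz : y <= z by rewrite ler_expR ler_pM2r ?invr_gt0.
have -> : z + z^-1 - (y + y^-1) = (z - y) * (y * z - 1) / (y * z).
  by field; rewrite !gt_eqF.
rewrite divr_ge0 ?mulr_ge0 ?subr_ge0 ?(ltW y0) ?(ltW z0) //.
by rewrite mulr_ege1 // (le_trans y1).
Qed.

(** The [lam] terms agree. The p + q - 2 clique terms are the same in number but all move to a
    strictly larger exponent, while the quadratic roots keep their sum and spread apart. *)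
Lemma SLEE_Kpqr_lt (R : realType) p q r : (1 < p)%N -> (1 < q)%N ->
  SLEE R (Kpqr p q r) < SLEE R (Kpqr (p + q).-1 1 r).
Proof.
move=> p1 q1; rewrite !SLEE_Kpqr //; try by lia.
have -> : ((p + q).-1)%:R = p%:R + q%:R - 1 :> R.
  by rewrite -subn1 natrB ?natrD //; lia.
set P : R := p%:R; set Q : R := q%:R; set S : R := r%:R.
have P2 : 2 <= P by rewrite (ler_nat R 2).
have Q2 : 2 <= Q by rewrite (ler_nat R 2).
have S0 : 0 <= S by rewrite ler0n.
rewrite subrr mul0r addr0 subrK.
apply: ltr_leD; last first.
  apply: expR_spread_le; first by rewrite sqrtr_ge0.
  (* The squares (p + q - 2)^2 and (p - q)^2 differ by 4 (p - 1)(q - 1). *)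
  rewrite ler_wsqrtr // !lerD2r ler_pM2l ?ltr0n //; nra.
rewrite -addrA ltrD2l.
have eP : expR (P + S - 2) < expR (P + Q - 1 + S - 2) by rewrite ltr_expR; lra.
have eQ : expR (Q + S - 2) < expR (P + Q - 1 + S - 2) by rewrite ltr_expR; lra.
nra.
Qed.

(** * Vertex cuts and embeddings into [Kpqr] *)

Section Separation.
Variables (G : sgraph) (A B S : {set G}).
Hypothesis ABS : forall x, ((x \in A) + (x \in B) + (x \in S) = 1)%N.
Hypothesis ABnadj : forall x y, x \in A -> y \in B -> ~~ adj x y.

Let sepP x : [\/ x \in A, x \in B | x \in S].
Proof.
have := ABS x; case: (x \in A); first by constructor 1.
by case: (x \in B); [constructor 2 | case: (x \in S); [constructor 3|]].
Qed.

Lemma card_separation : (#|A| + #|B| + #|S|)%N = #|G|.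
Proof.
have cardE (C : {set G}) : #|C| = (\sum_x (x \in C))%N.
  by rewrite -sum1_card big_mkcond; apply: eq_bigr => x _; case: (x \in C).
by rewrite !cardE -!big_split -sum1_card; apply: eq_bigr => x _; exact: ABS.
Qed.

(** Enumerating each of the three parts gives the map. The only distinct vertices non-adjacent in
    the target lie on opposite sides [A] and [B], where [G] has no edge either. *)
Lemma separation_hom : exists2 f : G -> Kpqr #|A| #|B| #|S|,
  bijective f & forall x y, adj x y -> adj (f x) (f y).
Proof.
have codeP x : {y : Kpqr #|A| #|B| #|S| |
    match y with
    | inl (inl i) => x = enum_val i
    | inl (inr i) => x = enum_val i
    | inr i => x = enum_val i
    end}.
  have [xA|xA] := boolP (x \in A).
    by exists (inl (inl (enum_rank_in xA x))); rewrite enum_rankK_in.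
  have [xB|xB] := boolP (x \in B).
    by exists (inl (inr (enum_rank_in xB x))); rewrite enum_rankK_in.
  have xS : x \in S by case: (sepP x) => // h; rewrite h in xA xB.
  by exists (inr (enum_rank_in xS x)); rewrite enum_rankK_in.
exists (fun x => sval (codeP x)) => [|x y].
  (* A vertex is determined by its code, so the map is injective; equal cardinalities make it
     bijective. *)
  apply: inj_card_bij => [x y xy|]; last first.
    by rewrite !card_sum !card_ord card_separation.
  have := svalP (codeP x); have := svalP (codeP y); rewrite xy.
  by case: (sval (codeP y)) => [[i|i]|i] -> ->.
have := svalP (codeP x); have := svalP (codeP y).
case: (sval (codeP x)) (sval (codeP y)) => [[i|i]|i] [[j|j]|j] //= -> ->.
- by rewrite /complete_adj; apply: contraTneq => ->; rewrite adj_irrefl.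
- by rewrite (negbTE (ABnadj _ _)) // enum_valP.
- by rewrite adj_sym (negbTE (ABnadj _ _)) // enum_valP.
- by rewrite /complete_adj; apply: contraTneq => ->; rewrite adj_irrefl.
- by rewrite /complete_adj; apply: contraTneq => ->; rewrite adj_irrefl.
Qed.

End Separation.

(** [A] is the component of one vertex after the removal of [S], and [B] is everything else outside
    [S]; an edge between them would extend the component. *)
Lemma cut_separation (G : sgraph) (S : {set G}) :
  ~~ graph_connected (remove_vertices S) ->
  exists A B : {set G}, [/\ (0 < #|A|)%N, (0 < #|B|)%N,
    forall x, ((x \in A) + (x \in B) + (x \in S) = 1)%N &
    forall x y, x \in A -> y \in B -> ~~ adj x y].
Proof.
rewrite negb_forall => /existsP[x0]; rewrite negb_forall => /existsP[y0 nc].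
pose H := remove_vertices S.
pose reach := connect (@adj H) x0.
pose A := [set val x | x : H & reach x].
pose B := [set val x | x : H & ~~ reach x].
have valA (x : H) : (val x \in A) = reach x.
  by rewrite (mem_imset _ _ val_inj) inE.
have valB (x : H) : (val x \in B) = ~~ reach x.
  by rewrite (mem_imset _ _ val_inj) inE.
exists A, B; split.
- by apply/card_gt0P; exists (val x0); rewrite valA /reach connect0.
- by apply/card_gt0P; exists (val y0); rewrite valB.
- move=> x; have [xS|xS] := boolP (x \in S).
    have notval (P : pred H) : x \notin [set val y | y : H & P y].
      by apply/imsetP => -[y _ xy]; have := valP y; rewrite -xy xS.
    by rewrite (negbTE (notval _)) (negbTE (notval _)).
  by rewrite -[x]/(val (Sub x xS : H)) valA valB; case: (reach _).
- move=> _ _ /imsetP[x + ->] /imsetP[y + ->]; rewrite !inE => rx.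
  by apply: contraNN => xy; apply: connect_trans rx (connect1 _).
Qed.

(** * Complete graphs, and the extremal bound for a given cut *)

Lemma complete_isomorphic (G H : sgraph) :
  #|G| = #|H| -> is_complete G -> is_complete H -> isomorphic G H.
Proof.
move=> cGH /forallP cG /forallP cH.
exists (fun x => enum_val (cast_ord cGH (enum_rank x))); split.
  exists (fun x => enum_val (cast_ord (esym cGH) (enum_rank x))) => x;
    by rewrite enum_valK ?cast_ordK ?cast_ordKV enum_rankK.
have adjE (K : sgraph) : (forall x : K, [forall y : K, (x != y) ==> adj x y]) ->
    forall x y : K, adj x y = (x != y).
  move=> cK x y; have /forallP/(_ y) := cK x.
  by case: eqVneq => [->|_ /= ->] //; rewrite adj_irrefl.
move=> x y; rewrite !adjE // (inj_eq enum_val_inj) (inj_eq (@cast_ord_inj _ _ _)).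
by rewrite (inj_eq enum_rank_inj).
Qed.

Lemma Kpqr_01_complete r : is_complete (Kpqr 0 1 r).
Proof.
apply/forallP => -[[[]//|a]|a]; apply/forallP => -[[[]//|b]|b] //=.
  by rewrite !ord1 eqxx.
exact/implyP.
Qed.

Lemma card_Kpqr p q r : #|Kpqr p q r| = (p + q + r)%N.
Proof. by rewrite !card_sum !card_ord. Qed.

(** If one side is a single vertex, [G] is a spanning subgraph of the target and the equality case
    for homomorphisms applies. Otherwise unbalancing the sides gives strict inequality, so equality
    cannot occur. *)
Lemma separation_SLEE_le (R : realType) (G : sgraph) (A B S : {set G}) :
  (0 < #|A|)%N -> (0 < #|B|)%N ->
  (forall x, ((x \in A) + (x \in B) + (x \in S) = 1)%N) ->
  (forall x y, x \in A -> y \in B -> ~~ adj x y) ->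
  SLEE R G <= SLEE R (Kpqr (#|A| + #|B|).-1 1 #|S|) /\
  (SLEE R G = SLEE R (Kpqr (#|A| + #|B|).-1 1 #|S|) ->
   isomorphic G (Kpqr (#|A| + #|B|).-1 1 #|S|)).
Proof.
have [B2|] := ltnP 1 #|B|; last first.
  move=> B1 A0 B0 ABS nadj; have BE : #|B| = 1%N by apply/eqP; rewrite eqn_leq B1.
  have [f f_bij f_hom] := separation_hom ABS nadj; rewrite BE in f f_bij f_hom *.
  rewrite addn1; split; first exact: SLEE_hom_le f_bij f_hom.
  exact: SLEE_hom_eq f_bij f_hom.
have [A2|] := ltnP 1 #|A|; last first.
  move=> A1 A0 B0 ABS nadj; have AE : #|A| = 1%N by apply/eqP; rewrite eqn_leq A1.
  (* The two sides are exchanged so that the singleton takes the second position. *)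
  have BAS x : ((x \in B) + (x \in A) + (x \in S) = 1)%N.
    by rewrite addnAC addnC addnA ABS.
  have nadj' x y : x \in B -> y \in A -> ~~ adj x y.
    by move=> xB yA; rewrite adj_sym nadj.
  have [f f_bij f_hom] := separation_hom BAS nadj'; rewrite AE in f f_bij f_hom *.
  rewrite add1n; split; first exact: SLEE_hom_le f_bij f_hom.
  exact: SLEE_hom_eq f_bij f_hom.
move=> _ _ ABS nadj; have [f f_bij f_hom] := separation_hom ABS nadj.
have lt : SLEE R G < SLEE R (Kpqr (#|A| + #|B|).-1 1 #|S|).
  exact: le_lt_trans (SLEE_hom_le R f_bij f_hom) (SLEE_Kpqr_lt R _ A2 B2).
by split=> [|eqGK]; [exact: ltW | rewrite eqGK ltxx in lt].
Qed.

Theorem theorem5p2 (R : realType) (G : sgraph) (n kappa : nat)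
    (n_gt0 : (0 < n)%N) (cardG : #|G| = n)
    (conG : vertex_connectivity G = kappa)
    (kappa_le : (0 <= kappa <= n - 1)%N) :
  SLEE R G <= SLEE R (Kpqr (n - 1 - kappa) 1 kappa) /\
  (SLEE R G = SLEE R (Kpqr (n - 1 - kappa) 1 kappa) <->
   isomorphic G (Kpqr (n - 1 - kappa) 1 kappa)).
Proof.
suff [le_GK eq_iso] : SLEE R G <= SLEE R (Kpqr (n - 1 - kappa) 1 kappa) /\
    (SLEE R G = SLEE R (Kpqr (n - 1 - kappa) 1 kappa) ->
     isomorphic G (Kpqr (n - 1 - kappa) 1 kappa)).
  by split=> //; split=> //; apply: SLEE_isomorphic.
have [cG|ncG] := boolP (is_complete G).
  have iso : isomorphic G (Kpqr (n - 1 - kappa) 1 kappa).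
    (* For complete [G], [kappa] is n - 1 by convention, so the first parameter vanishes and the
       target is itself complete on n vertices. *)
    have kE : kappa = n.-1 by rewrite -conG /vertex_connectivity cG cardG.
    rewrite kE subn1 subnn; apply: complete_isomorphic cG (Kpqr_01_complete _).
    by rewrite card_Kpqr cardG add1n prednK.
  by split=> //; rewrite (SLEE_isomorphic R iso).
have [S ncS] := vertex_connectivity_attained ncG; rewrite conG => ->.
have [A [B [A0 B0 ABS nadj]]] := cut_separation ncS.
have -> : (n - 1 - #|S| = (#|A| + #|B|).-1)%N.
  by have := card_separation ABS; rewrite cardG; lia.
exact: separation_SLEE_le.
Qed.
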